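(* For any $i\in I^{re}$ and $(j,l)\in I^\infty$ with $i\neq(j,l)$ (i.e. $(i,1)\ne(j,l)$), one has in $U_q(\mathfrak g)$ $$\sum_{p+p'=1-la_{ij}}(-1)^p\,t_i^{(p)}\,t_{jl}\,t_i^{(p')}=0,$$ where the sum is over integers $p,p'\ge0$.
   Context: **Cartan datum.** $I$ is a countable (possibly infinite) index set; $A=(a_{ij})_{i,j\in I}$ is an integer matrix with $a_{ii}\in\{2,0,-2,-4,\dots\}$, $a_{ij}\le 0$ for $i\ne j$, and there are positive integers $r_i$ with $r_ia_{ij}=r_ja_{ji}$. $I^{re}=\{i:a_{ii}=2\}$, $I^{im}=\{i:a_{ii}\le0\}$, $I^\infty=(I^{re}\times\{1\})\cup(I^{im}\times\mathbb Z_{>0})$; for $i\in I^{re}$ write $i$ for $(i,1)$. $P^\vee$ is the free abelian group with basis $\{h_i,d_i: i\in I\}$, $\mathfrak h=\mathbb Q\otimes_{\mathbb Z}P^\vee$. The simple roots $\alpha_i\in\mathfrak h^*$ satisfy $\alpha_j(h_i)=a_{ij}$, $\alpha_j(d_i)=\delta_{ij}$. $(\ ,\ )$ is the symmetric bilinear form with $(\alpha_i,\lambda)=r_i\lambda(h_i)$, so $(\alpha_i,\alpha_j)=r_ia_{ij}$. **Quantum Borcherds-Bozec algebra.** $q$ is an indeterminate, $q_i=q^{r_i}$, $q_{(i)}=q^{(\alpha_i,\alpha_i)/2}$; for $i\in I^{re}$, $[n]_i=\frac{q_i^n-q_i^{-n}}{q_i-q_i^{-1}}$, with the associated $q$-factorials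 $[n]_i!$ and $q$-binomials. $\mathscr F$ is the free associative $\mathbb Q(q)$-algebra on $f_{il}$ $((i,l)\in I^\infty)$, graded by $|f_{il}|=-l\alpha_i$, and $\mathscr F\otimes\mathscr F$ has the twisted product $(x_1\otimes x_2)(y_1\otimes y_2)=q^{-(|x_2|,|y_1|)}x_1y_1\otimes x_2y_2$; $\delta:\mathscr F\to\mathscr F\otimes\mathscr F$ is the algebra map $\delta(f_{il})=\sum_{m+n=l}q_{(i)}^{-mn}f_{im}\otimes f_{in}$ (with $f_{i0}=1$). Fix nonzero $\nu_{il}\in\mathbb Q(q)$ with $\nu_{il}\in1+q\mathbb Z_{\ge0}[[q]]$. $(\ ,\ )_L$ is the symmetric bilinear form on $\mathscr F$ with $(x,y)_L=0$ if $|x|\ne|y|$, $(1,1)_L=1$, $(f_{il},f_{il})_L=\nu_{il}$, $(x,yz)_L=(\delta(x),y\otimes z)_L$. $\widehat U$ is the $\mathbb Q(q)$-algebra generated by $q^h$ $(h\in P^\vee)$, $e_{il},f_{il}$ $((i,l)\in I^\infty)$ with relations $q^0=1$, $q^hq^{h'}=q^{h+h'}$, $q^he_{jl}q^{-h}=q^{l\alpha_j(h)}e_{jl}$, $q^hf_{jl}q^{-h}=q^{-l\alpha_j(h)}f_{jl}$; $\sum_{k=0}^{1-la_{ij}}(-1)^k\begin{bmatrix}1-la_{ij}\\k\end{bmatrix}_ix_i^{1-la_{ij}-k}x_{jl}x_i^k=0$ for $x=e$ and $x=f$, $i\in I^{re}$, $i\ne(j,l)$; $[e_{ik},e_{jl}]=[f_{ik},f_{jl}]=0$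 if $a_{ij}=0$. With $K_i=q_i^{h_i}=q^{r_ih_i}$, its comultiplication is $\Delta(q^h)=q^h\otimes q^h$, $\Delta(e_{il})=\sum_{m+n=l}q_{(i)}^{mn}e_{im}\otimes K_i^{-m}e_{in}$, $\Delta(f_{il})=\sum_{m+n=l}q_{(i)}^{-mn}f_{im}K_i^n\otimes f_{in}$. $\omega$ is the involution $q^h\mapsto q^{-h}$, $e_{il}\leftrightarrow f_{il}$. The form $(\ ,\ )_L$ extends to $\widehat U$ (Bozec) with $(q^h,1)_L=1$, $(q^h,f_{il})_L=0$, $(q^h,K_j)_L=q^{-\alpha_j(h)}$, $(x,y)_L=(\omega(x),\omega(y))_L$ for $x,y$ in the subalgebra $\widehat U^+$ generated by the $e_{il}$, and on the subalgebra $\widehat U^{\le0}$ generated by the $f_{il},q^h$ it is compatible with $\Delta$: $(x,yz)_L=(\Delta(x),y\otimes z)_L$. $\widetilde U$ is the quotient of $\widehat U$ by the relations (Sweedler notation) $\sum(a_{(1)},b_{(2)})_L\,\omega(b_{(1)})a_{(2)}=\sum(a_{(2)},b_{(1)})_L\,a_{(1)}\omega(b_{(2)})$ for $a,b\in\widehat U^{\le0}$. The quantum Borcherds-Bozec algebra $U_q(\mathfrak g)$ is the quotient of $\widetilde U$ by the radical of $(\ ,\ )_L$ restricted to $\widetilde U^-\times\widetilde U^+$. $U^-$ denotes the subalgebra of $U_q(\mathfrak g)$ generated by the $f_{il}$; it is identified with the quotient of $\mathscr F$ by the radical of $(\ ,\ )_L$. **Primitive generators.** (Bozec) For $i\in I^{im}$,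 $l\ge1$ there is a unique $t_{il}\in U^-$ of degree $-l\alpha_i$ such that $t_{il}-f_{il}$ lies in the subalgebra generated by $f_{ik}$, $k<l$, and $(t_{il},z)_L=0$ for all $z$ in that subalgebra; it satisfies $\delta(t_{il})=t_{il}\otimes1+1\otimes t_{il}$. For $i\in I^{re}$ put $t_i=t_{i1}=f_{i1}$, and $t_i^{(n)}=t_i^n/[n]_i!$ for $n\ge0$. *)

(* Defs.v *)
From HB Require Import structures.
From mathcomp Require Import all_boot all_order all_algebra.
From mathcomp Require Import boolp.
From mathcomp Require Import finmap monalg.

Set Implicit Arguments.
Unset Strict Implicit.
Unset Printing Implicit Defensive.

Import GRing.Theory Num.Theory.
Local Open Scope ring_scope.
Local Open Scope quotient_scope.

Section GeneratedSubobjects.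
Variables (k : nzRingType) (A : lalgType k).

Inductive subalg (S : A -> Prop) : A -> Prop :=
| SubalgGen x of S x : subalg S x
| SubalgOne : subalg S 1
| SubalgLin c x y of subalg S x & subalg S y : subalg S (c *: x + y)
| SubalgMul x y of subalg S x & subalg S y : subalg S (x * y).

Inductive ideal (S : A -> Prop) : A -> Prop :=
| IdealGen x of S x : ideal S x
| IdealZero : ideal S 0
| IdealAdd x y of ideal S x & ideal S y : ideal S (x + y)
| IdealMull a x of ideal S x : ideal S (a * x)
| IdealMulr a x of ideal S x : ideal S (x * a).

End GeneratedSubobjects.

(* The algebra presented by the relations s = 0, s ranging over S.  Since the
   quotient may a priori be zero, it is a pzRingType and an lmodType rather
   than an algType, which mathcomp requires to be nontrivial. *)
Section AlgebraQuotient.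
Variables (k : nzRingType) (A : lalgType k) (S : A -> Prop).

Lemma idealN x : ideal S x -> ideal S (- x).
Proof. by move=> Sx; rewrite -mulN1r; exact: IdealMull. Qed.

Lemma idealZ c x : ideal S x -> ideal S (c *: x).
Proof. by move=> Sx; rewrite -mulr_algl; exact: IdealMull. Qed.

Definition ideal_rel : rel A := fun x y => `[< ideal S (x - y) >].

Lemma ideal_relP x y : reflect (ideal S (x - y)) (ideal_rel x y).
Proof. exact: asboolP. Qed.

Lemma ideal_rel_refl : reflexive ideal_rel.
Proof. by move=> x; apply/ideal_relP; rewrite subrr; exact: IdealZero. Qed.

Lemma ideal_rel_sym : symmetric ideal_rel.
Proof.
by move=> x y; apply/ideal_relP/ideal_relP => /idealN; rewrite opprB.
Qed.

Lemma ideal_rel_trans : transitive ideal_rel.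
Proof.
move=> y x z /ideal_relP xy /ideal_relP yz; apply/ideal_relP.
by rewrite -(subrKA y); exact: IdealAdd.
Qed.

Definition ideal_equiv :=
  EquivRel ideal_rel ideal_rel_refl ideal_rel_sym ideal_rel_trans.

Definition alg_quot := {eq_quot ideal_equiv}.
HB.instance Definition _ := Quotient.on alg_quot.
HB.instance Definition _ := Choice.on alg_quot.

Definition aq_class (x : A) : alg_quot := \pi_alg_quot x.

Lemma aq_classP x y : aq_class x = aq_class y <-> ideal S (x - y).
Proof.
by split=> [/eqP|Sxy]; [|apply/eqP]; rewrite /aq_class eqmodE;
   [move/ideal_relP|apply/ideal_relP].
Qed.

Lemma aq_repr x : ideal S (repr (aq_class x) - x).
Proof. by apply/aq_classP; rewrite /aq_class reprK. Qed.

Lemma aq_classK (u : alg_quot) : aq_class (repr u) = u.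
Proof. exact: reprK. Qed.

Definition aq_zero := aq_class 0.
Definition aq_one := aq_class 1.
Definition aq_opp (u : alg_quot) := aq_class (- repr u).
Definition aq_add (u v : alg_quot) := aq_class (repr u + repr v).
Definition aq_mul (u v : alg_quot) := aq_class (repr u * repr v).
Definition aq_scale c (u : alg_quot) := aq_class (c *: repr u).

Lemma aq_oppE x : aq_opp (aq_class x) = aq_class (- x).
Proof. by apply/aq_classP; rewrite -opprD; apply: idealN; exact: aq_repr. Qed.

Lemma aq_addE x y : aq_add (aq_class x) (aq_class y) = aq_class (x + y).
Proof.
apply/aq_classP; rewrite opprD addrACA.
by apply: IdealAdd; exact: aq_repr.
Qed.

Lemma aq_mulE x y : aq_mul (aq_class x) (aq_class y) = aq_class (x * y).
Proof.
apply/aq_classP; set x' := repr _; set y' := repr _.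
have -> : x' * y' - x * y = (x' - x) * y' + x * (y' - y).
  by rewrite mulrBl mulrBr subrKA.
by apply: IdealAdd; [apply: IdealMulr|apply: IdealMull]; exact: aq_repr.
Qed.

Lemma aq_scaleE c x : aq_scale c (aq_class x) = aq_class (c *: x).
Proof. by apply/aq_classP; rewrite -scalerBr; apply: idealZ; exact: aq_repr. Qed.

Lemma aq_ind (P : alg_quot -> Prop) : (forall x, P (aq_class x)) -> forall u, P u.
Proof. by move=> Pc u; rewrite -(aq_classK u). Qed.

Lemma aq_addA : associative aq_add.
Proof.
by elim/aq_ind=> x; elim/aq_ind=> y; elim/aq_ind=> z; rewrite !aq_addE addrA.
Qed.
Lemma aq_addC : commutative aq_add.
Proof. by elim/aq_ind=> x; elim/aq_ind=> y; rewrite !aq_addE addrC. Qed.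
Lemma aq_add0 : left_id aq_zero aq_add.
Proof. by elim/aq_ind=> x; rewrite aq_addE add0r. Qed.
Lemma aq_addN : left_inverse aq_zero aq_opp aq_add.
Proof. by elim/aq_ind=> x; rewrite aq_oppE aq_addE addNr. Qed.
HB.instance Definition _ :=
  GRing.isZmodule.Build alg_quot aq_addA aq_addC aq_add0 aq_addN.

Lemma aq_mulA : associative aq_mul.
Proof.
by elim/aq_ind=> x; elim/aq_ind=> y; elim/aq_ind=> z; rewrite !aq_mulE mulrA.
Qed.
Lemma aq_mul1 : left_id aq_one aq_mul.
Proof. by elim/aq_ind=> x; rewrite aq_mulE mul1r. Qed.
Lemma aq_mulr1 : right_id aq_one aq_mul.
Proof. by elim/aq_ind=> x; rewrite aq_mulE mulr1. Qed.
Lemma aq_mulDl : left_distributive aq_mul aq_add.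
Proof.
elim/aq_ind=> x; elim/aq_ind=> y; elim/aq_ind=> z.
by rewrite !(aq_addE, aq_mulE) mulrDl.
Qed.
Lemma aq_mulDr : right_distributive aq_mul aq_add.
Proof.
elim/aq_ind=> x; elim/aq_ind=> y; elim/aq_ind=> z.
by rewrite !(aq_addE, aq_mulE) mulrDr.
Qed.
HB.instance Definition _ := GRing.Zmodule_isPzRing.Build alg_quot
  aq_mulA aq_mul1 aq_mulr1 aq_mulDl aq_mulDr.

Lemma aq_scaleA a b u : aq_scale a (aq_scale b u) = aq_scale (a * b) u.
Proof. by elim/aq_ind: u => x; rewrite !aq_scaleE scalerA. Qed.
Lemma aq_scale1 : left_id 1 aq_scale.
Proof. by elim/aq_ind=> x; rewrite aq_scaleE scale1r. Qed.
Lemma aq_scaleDr : right_distributive aq_scale +%R.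
Proof.
move=> c; elim/aq_ind=> x; elim/aq_ind=> y.
by rewrite /+%R /= !(aq_addE, aq_scaleE) scalerDr.
Qed.
Lemma aq_scaleDl u : {morph aq_scale^~ u : a b / a + b}.
Proof.
move=> a b; elim/aq_ind: u => x.
by rewrite [RHS]/+%R /= !(aq_addE, aq_scaleE) scalerDl.
Qed.
HB.instance Definition _ := GRing.Zmodule_isLmodule.Build k alg_quot
  aq_scaleA aq_scale1 aq_scaleDr aq_scaleDl.

End AlgebraQuotient.

Definition Qq := {fraction {poly rat}}.
HB.instance Definition _ := GRing.Field.on Qq.

Definition qvar : Qq := tofrac 'X.

Definition free_alg (X : choiceType) := {malg Qq[{fmonom X}]}.
HB.instance Definition _ (X : choiceType) := GRing.Lalgebra.on (free_alg X).

Section FreeAlgebra.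
Variable X : choiceType.
Local Notation A := (free_alg X).
Local Notation word := {fmonom X}.

Definition wordE (w : word) : A := << w >>.
Definition letterE (x : X) : A := << fmu x >>.

(* the algebra morphism extending h *)
Definition free_ext (B : lalgType Qq) (h : X -> B) (x : A) : B :=
  \sum_(w <- msupp x) x@_w *: \prod_(g <- (w : seq X)) h g.

(* A (x) A, on its basis of pairs of words *)
Definition free_tens := {malg Qq[(word * word)%type]}.

Definition tens (x y : A) : free_tens :=
  \sum_(u <- msupp x) \sum_(v <- msupp y) << x@_u * y@_v *g (u, v) >>.

(* (x1 (x) x2)(y1 (x) y2) = c(x2, y1) x1 y1 (x) x2 y2 on words *)
Definition twist_mul (c : word -> word -> Qq) (s t : free_tens) : free_tens :=
  \sum_(a <- msupp s) \sum_(b <- msupp t)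
    << s@_a * t@_b * c a.2 b.1 *g (mmul a.1 b.1, mmul a.2 b.2) >>.

(* the algebra morphism from A to (A (x) A, twist_mul c) extending d *)
Definition tens_ext (c : word -> word -> Qq) (d : X -> free_tens) (x : A)
    : free_tens :=
  \sum_(w <- msupp x)
    x@_w *: foldr (fun g s => twist_mul c (d g) s) (tens 1 1) (w : seq X).

(* tens_forml B s y z = (s, y (x) z) and tens_formr B x y s = (x (x) y, s) *)
Definition tens_forml (B : A -> A -> Qq) (s : free_tens) (y z : A) : Qq :=
  \sum_(a <- msupp s) s@_a * (B (wordE a.1) y * B (wordE a.2) z).

Definition tens_formr (B : A -> A -> Qq) (x y : A) (s : free_tens) : Qq :=
  \sum_(a <- msupp s) s@_a * (B x (wordE a.1) * B y (wordE a.2)).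

End FreeAlgebra.

Record cartan_datum := CartanDatum {
  idx : countType;
  cart : idx -> idx -> int;
  symz : idx -> nat;
  cart_diag : forall i,
    cart i i = 2 \/ exists m : nat, cart i i = - (2 * m)%N%:Z;
  cart_offdiag : forall i j, i != j -> cart i j <= 0;
  symz_gt0 : forall i, (0 < symz i)%N;
  cart_symz : forall i j,
    (symz i)%:Z * cart i j = (symz j)%:Z * cart j i
}.

Section CartanDatum.
Variable D : cartan_datum.
Local Notation I := (idx D).
Local Notation a := (@cart D).
Local Notation r := (@symz D).

Definition is_re (i : I) : bool := a i i == 2.

Definition Iinf_pred (p : I * nat) : bool :=
  if is_re p.1 then p.2 == 1%N else (0 < p.2)%N.

Definition Iinf := {p : I * nat | Iinf_pred p}.

Lemma Iinf_re_subproof i : is_re i -> Iinf_pred (i, 1%N).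
Proof. by rewrite /Iinf_pred /= => ->. Qed.

Definition Iinf_re i (hi : is_re i) : Iinf := exist _ (i, 1%N) (Iinf_re_subproof hi).

(* inl i stands for h_i and inr i for d_i *)
Definition Pvee := {malg int[(I + I)%type]}.

Definition hvee (i : I) : Pvee := << inl i >>.
Definition dvee (i : I) : Pvee := << inr i >>.

(* Elements of h^* taking integral values on P^vee. *)
Definition weight := Pvee -> int.

Definition alpha (j : I) : weight := fun h =>
  \sum_(k <- msupp h)
    h@_k * match k with inl i => a i j | inr i => (i == j)%:Z end.

Definition q_i (i : I) : Qq := qvar ^+ r i.

(* q^{(alpha_i, alpha_i) / 2}; the division is exact as a i i is even *)
Definition q_p (i : I) : Qq := qvar ^ (((r i)%:Z * a i i) %/ 2)%Z.

Definition qint (i : I) (n : nat) : Qq :=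
  (q_i i ^+ n - q_i i ^- n) / (q_i i - (q_i i)^-1).

Definition qfact (i : I) (n : nat) : Qq := \prod_(1 <= m < n.+1) qint i m.

Definition qbinom (i : I) (n m : nat) : Qq :=
  qfact i n / (qfact i m * qfact i (n - m)).

(* 1 - l a_ij for x = (j, l); nonnegative when i is real and (i, 1) != x *)
Definition serre_len (i : I) (x : Iinf) : nat :=
  absz (1 - (val x).2%:Z * a i (val x).1)%R.

(* nu is nonzero and lies in 1 + q Z_{>=0}[[q]]: it is a quotient of
   polynomials num / den with den(0) != 0, whose Taylor expansion is c *)
Definition nu_admissible (nu : Qq) : Prop :=
  nu != 0 /\
  exists (c : nat -> nat) (num den : {poly rat}),
    [/\ den`_0 != 0, nu = tofrac num / tofrac den, c 0 = 1%N &
        forall n, num`_n = \sum_(m < n.+1) den`_m * (c (n - m)%N)%:R].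

Definition Falg := free_alg Iinf.

(* f_il, with f_i0 = 1 *)
Definition fF (i : I) (l : nat) : Falg :=
  if l == 0%N then 1
  else if insub (i, l) is Some x then letterE x else 0.

Definition degF (w : {fmonom Iinf}) : weight := fun h =>
  - \sum_(x <- (w : seq Iinf)) (val x).2%:Z * alpha (val x).1 h.

Definition homog (mu : weight) (x : Falg) : Prop :=
  forall w, w \in msupp x -> degF w =1 mu.

(* (|u|, lambda), from (alpha_i, lambda) = r_i lambda(h_i) *)
Definition deg_form (u : {fmonom Iinf}) (lambda : weight) : int :=
  - \sum_(x <- (u : seq Iinf))
      (val x).2%:Z * ((r (val x).1)%:Z * lambda (hvee (val x).1)).

Definition deltaF : Falg -> free_tens Iinf :=
  tens_ext (fun u v => qvar ^ (- deg_form u (degF v)))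
    (fun x => let: (i, l) := val x in
       \sum_(m < l.+1) q_p i ^- (m * (l - m)) *: tens (fF i m) (fF i (l - m))).

Record is_formL (nu : Iinf -> Qq) (L : Falg -> Falg -> Qq) : Prop := IsFormL {
  formL_sym : forall x y, L x y = L y x;
  formL_deg : forall (mu mu' : weight) x y,
    homog mu x -> homog mu' y -> ~ (mu =1 mu') -> L x y = 0;
  formL_one : L 1 1 = 1;
  formL_gen : forall x : Iinf, L (letterE x) (letterE x) = nu x;
  formL_delta : forall x y z : Falg,
    L x (y * z) = tens_forml L (deltaF x) y z
}.

(* Uhat, Utilde and U_q(g) are successive quotients.  They are all presented as
   quotients of the free algebra T on the q^h, e_il, f_il, by increasing sets of
   relations, so that Delta and Sweedler sums can be written on words. *)

Definition gen := (Pvee + (Iinf + Iinf))%type.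

Definition Talg := free_alg gen.

Definition qT (h : Pvee) : Talg := letterE (inl h : gen).
Definition eTg (x : Iinf) : Talg := letterE (inr (inl x) : gen).
Definition fTg (x : Iinf) : Talg := letterE (inr (inr x) : gen).

(* e_il and f_il, with e_i0 = f_i0 = 1 *)
Definition eT (i : I) (l : nat) : Talg :=
  if l == 0%N then 1 else if insub (i, l) is Some x then eTg x else 0.
Definition fT (i : I) (l : nat) : Talg :=
  if l == 0%N then 1 else if insub (i, l) is Some x then fTg x else 0.

Definition KT (i : I) : Talg := qT (hvee i *+ r i).
Definition KTinv (i : I) : Talg := qT (hvee i *- r i).

Definition serre (g : Iinf -> Talg) (i : I) (hi : is_re i) (x : Iinf) : Talg :=
  let N := serre_len i x in let y := g (Iinf_re hi) in
  \sum_(k < N.+1) ((-1) ^+ k * qbinom i N k) *: (y ^+ (N - k) * g x * y ^+ k).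

Inductive rel_hat : Talg -> Prop :=
| RelQ0 : rel_hat (qT 0 - 1)
| RelQD h h' : rel_hat (qT h * qT h' - qT (h + h'))
| RelQE h x : rel_hat (qT h * eTg x * qT (- h)
    - qvar ^ ((val x).2%:Z * alpha (val x).1 h) *: eTg x)
| RelQF h x : rel_hat (qT h * fTg x * qT (- h)
    - qvar ^ (- ((val x).2%:Z * alpha (val x).1 h)) *: fTg x)
| RelSerreE i (hi : is_re i) x of val x != (i, 1%N) : rel_hat (serre eTg hi x)
| RelSerreF i (hi : is_re i) x of val x != (i, 1%N) : rel_hat (serre fTg hi x)
| RelCommE x y of a (val x).1 (val y).1 = 0 :
    rel_hat (eTg x * eTg y - eTg y * eTg x)
| RelCommF x y of a (val x).1 (val y).1 = 0 :
    rel_hat (fTg x * fTg y - fTg y * fTg x).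

Definition Uhat := alg_quot rel_hat.

Definition to_hat (x : Talg) : Uhat := aq_class rel_hat x.

(* The comultiplication and the involution of Uhat, on the free algebra T;
   both are compatible with the relations rel_hat. *)
Definition DeltaT : Talg -> free_tens gen :=
  tens_ext (fun _ _ => 1) (fun g => match g with
    | inl h => tens (qT h) (qT h)
    | inr (inl x) => let: (i, l) := val x in
        \sum_(m < l.+1) q_p i ^+ (m * (l - m)) *:
          tens (eT i m) (KTinv i ^+ m * eT i (l - m))
    | inr (inr x) => let: (i, l) := val x in
        \sum_(m < l.+1) q_p i ^- (m * (l - m)) *:
          tens (fT i m * KT i ^+ (l - m)) (fT i (l - m))
    end).

Definition omegaT : Talg -> Talg :=
  free_ext (fun g : gen => match g with
    | inl h => qT (- h)
    | inr (inl x) => fTg x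
    | inr (inr x) => eTg x
    end).

Definition F_to_T : Falg -> Talg := free_ext fTg.

Definition Tplus := subalg (fun y : Talg => exists x, y = eTg x).
Definition Tminus := subalg (fun y : Talg => exists x, y = fTg x).

(* maps onto Uhat^{<= 0} *)
Definition Tle0 := subalg (fun y : Talg =>
  (exists h, y = qT h) \/ (exists x, y = fTg x)).

(* the same, with only the elements K_i^{+-1} of the torus *)
Definition Tle0K := subalg (fun y : Talg =>
  (exists i, y = KT i \/ y = KTinv i) \/ (exists x, y = fTg x)).

(* The extension of (,)_L to Uhat.  A form satisfying (q^h, K_j) = q^{-alpha_j(h)}
   and compatible with Delta on all of Uhat^{<= 0} x Uhat^{<= 0} does not exist
   over Q(q) when some r_j > 1: (q^{d_j}, q^{h_j}) would be an r_j-th root of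
   q^{-1}.  The right argument is therefore restricted to the subalgebra
   generated by the f_il and the K_i^{+-1}, where the conditions below determine
   the form. *)
Record is_formhat (L : Falg -> Falg -> Qq) (Lh : Uhat -> Uhat -> Qq) : Prop :=
    IsFormhat {
  formhat_L : forall x y,
    Lh (to_hat (F_to_T x)) (to_hat (F_to_T y)) = L x y;
  formhat_q1 : forall h, Lh (to_hat (qT h)) 1 = 1;
  formhat_qf : forall h x, Lh (to_hat (qT h)) (to_hat (fTg x)) = 0;
  formhat_qK : forall h j,
    Lh (to_hat (qT h)) (to_hat (KT j)) = qvar ^ (- alpha j h);
  formhat_sym : forall x y, Tle0K x -> Tle0K y ->
    Lh (to_hat x) (to_hat y) = Lh (to_hat y) (to_hat x);
  formhat_Deltal : forall x y z, Tle0 x -> Tle0K y -> Tle0K z ->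
    Lh (to_hat x) (to_hat (y * z)) =
    tens_forml (fun u v => Lh (to_hat u) (to_hat v)) (DeltaT x) y z;
  formhat_Deltar : forall x y z, Tle0 x -> Tle0 y -> Tle0K z ->
    Lh (to_hat (x * y)) (to_hat z) =
    tens_formr (fun u v => Lh (to_hat u) (to_hat v)) x y (DeltaT z);
  formhat_omega : forall x y, Tplus x -> Tplus y ->
    Lh (to_hat x) (to_hat y) = Lh (to_hat (omegaT x)) (to_hat (omegaT y))
}.

Section QuantumGroup.
Variable Lh : Uhat -> Uhat -> Qq.
Local Notation LT x y := (Lh (to_hat x) (to_hat y)).

(* sum (a_(1), b_(2)) omega(b_(1)) a_(2) and sum (a_(2), b_(1)) a_(1) omega(b_(2)) *)
Definition double_l (x y : Talg) : Talg :=
  \sum_(s <- msupp (DeltaT x)) \sum_(t <- msupp (DeltaT y))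
    ((DeltaT x)@_s * (DeltaT y)@_t * LT (wordE s.1) (wordE t.2)) *:
      (omegaT (wordE t.1) * wordE s.2).
Definition double_r (x y : Talg) : Talg :=
  \sum_(s <- msupp (DeltaT x)) \sum_(t <- msupp (DeltaT y))
    ((DeltaT x)@_s * (DeltaT y)@_t * LT (wordE s.2) (wordE t.1)) *:
      (wordE s.1 * omegaT (wordE t.2)).

Inductive rel_tilde : Talg -> Prop :=
| RelHat x of rel_hat x : rel_tilde x
| RelDouble x y of Tle0 x & Tle0K y : rel_tilde (double_l x y - double_r x y).

Definition Utilde := alg_quot rel_tilde.

(* The form on U^- x U^+ is (x, y) |-> (x, omega(y))_L; both its radicals are
   killed. *)
Inductive rel_U : Talg -> Prop :=
| RelTilde x of rel_tilde x : rel_U x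
| RelRadMinus x of Tminus x & (forall y, Tplus y -> LT x (omegaT y) = 0) : rel_U x
| RelRadPlus y of Tplus y & (forall x, Tminus x -> LT x (omegaT y) = 0) : rel_U y.

Definition Uq := alg_quot rel_U.

(* the canonical map F -> U_q(g), of image U^- *)
Definition F_to_U (x : Falg) : Uq := aq_class rel_U (F_to_T x).

Definition fU (x : Iinf) : Uq := F_to_U (letterE x).

(* (u, v)_L = c, for the form induced on U^- = F / rad *)
Definition formU (L : Falg -> Falg -> Qq) (u v : Uq) (c : Qq) : Prop :=
  exists x y : Falg, [/\ F_to_U x = u, F_to_U y = v & L x y = c].

Definition homogU (mu : weight) (u : Uq) : Prop :=
  exists2 x : Falg, homog mu x & F_to_U x = u.

(* the subalgebra of U^- generated by the f_ik, 0 < k < l *)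
Definition subU_lt (i : I) (l : nat) (u : Uq) : Prop :=
  exists2 x : Falg,
    subalg (fun y => exists2 k, (0 < k < l)%N & y = fF i k) x & F_to_U x = u.

Record is_primitive_gen (L : Falg -> Falg -> Qq) (x : Iinf) (u : Uq) : Prop :=
    IsPrimitiveGen {
  prim_deg : homogU (fun h => - ((val x).2%:Z * alpha (val x).1 h)) u;
  prim_sub : subU_lt (val x).1 (val x).2 (u - fU x);
  prim_orth : forall z, subU_lt (val x).1 (val x).2 z -> formU L u z 0
}.

Definition primitive_family (L : Falg -> Falg -> Qq) (t : Iinf -> Uq) : Prop :=
  forall x : Iinf,
    if is_re (val x).1 then t x = fU x else is_primitive_gen L x (t x).

Definition divpow (i : I) (u : Uq) (n : nat) : Uq := (qfact i n)^-1 *: u ^+ n.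

End QuantumGroup.

End CartanDatum.

(* Main.v *)
Require Import Defs.
From HB Require Import structures.
From mathcomp Require Import all_boot all_order all_algebra.
From mathcomp Require Import finmap monalg ring zify.
Set Implicit Arguments.
Unset Strict Implicit.
Unset Printing Implicit Defensive.
Import GRing.Theory.
Local Open Scope ring_scope.

(** Fix a real index i, write Q = q_i and y = f_i, and let ad_s(w) = y w - s w y
    be the q-commutator with y of parameter s.  The product of the N commuting
    operators ad_s, ad_(s Q^2), .., ad_(s Q^(2 N - 2)) is called qad below.  By
    the q-binomial theorem, at s = Q^(1 - N) its value on w is, up to a nonzero
    scalar, the sum of the terms (-1)^p y^(p) w y^(N - p) in divided powers
    (serre_divided_powers).  The claim is thus that t_jl is killed by qad for
    N = 1 - l a_ij and s = Q^(l a_ij).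

    The defining Serre relations say exactly this for the generators f_jk, with
    k in place of l (qad_fU), which settles the case of a real j.  The point is
    that these annihilation properties are stable under products.  Indeed
    s = Q^(l a_ij) is multiplicative in l, ad satisfies the q-Leibniz rule
      ad_(s s')(w w') = ad_s(w) w' + s w ad_s'(w'),
    and hence, as for the nilpotency orders of two vectors under an ordinary
    derivation, orders 1 + p and 1 + p' for the factors give order 1 + p + p' for
    the product (qad_mul_eq0).  A word in the f_jk of total degree l, whose
    factors have orders 1 - k a_ij, therefore has order 1 - l a_ij.

    For j imaginary, t_jl is a polynomial in the f_jk with k <= l, and it remains
    to discard the words of total degree other than l.  Conjugation by q^(d_j)
    multiplies a word of degree m by q^(-m), and t_jl by q^(-l) because t_jl has
    weight -l alpha_j.  Eigenvectors for distinct eigenvalues being linearly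
    independent, the unwanted part of the polynomial vanishes in U_q(g)
    (eigen_sum_filter, serre_span_homog). *)

(** * Components of an eigenvector in a sum of eigenvectors *)

Section EigenSum.
Variables (K : fieldType) (V : lmodType K) (c : {linear V -> V}).

(** Linear independence of eigenspaces, for a sum in which eigenvalues may
    repeat: applying c - b, for b the eigenvalue of the first term, removes that
    term, keeps the others eigenvectors and multiplies v by a - b. *)
Lemma eigen_sum_eq0 (a : K) (s : seq (K * V)) (v : V) :
  {in s, forall p, p.1 != a /\ c p.2 = p.1 *: p.2} ->
  c v = a *: v -> v = \sum_(p <- s) p.2 -> v = 0.
Proof.
have [n] := ubnP (size s); elim: n s v => // n IHn [|[b w] s] v /=.
  by rewrite big_nil.
rewrite ltnS => le_sn Hs cv.
have [/= b_neq cw] := Hs _ (mem_head _ _).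
rewrite big_cons /= => v_sum.
pose s' := [seq (p.1, (p.1 - b) *: p.2) | p <- s].
have : (a - b) *: v = 0.
  apply: (IHn s') => [|p /mapP[p' p's ->] /=||].
  - by rewrite size_map.
  - have [|p_neq cp] := Hs p'; first by rewrite inE p's orbT.
    by rewrite linearZ /= cp !scalerA mulrC.
  - by rewrite linearZ /= cv !scalerA mulrC.
  have -> : (a - b) *: v = c v - b *: v by rewrite scalerBl cv.
  rewrite {}v_sum linearD linear_sum /= cw scalerDr.
  rewrite (addrC (b *: w)) addrKA big_map scaler_sumr.
  rewrite -sumrB; apply: eq_big_seq => p ps /=.
  have [|_ ->] := Hs p; first by rewrite inE ps orbT.
  by rewrite scalerBl.
by move/eqP; rewrite scaler_eq0 subr_eq0 eq_sym (negPf b_neq) => /eqP.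
Qed.

Lemma eigen_sum_filter (a : K) (s : seq (K * V)) (v : V) :
  {in s, forall p, c p.2 = p.1 *: p.2} ->
  c v = a *: v -> v = \sum_(p <- s) p.2 ->
  v = \sum_(p <- s | p.1 == a) p.2.
Proof.
move=> Hs cv v_sum; apply/eqP; rewrite -subr_eq0; apply/eqP.
apply: (@eigen_sum_eq0 a [seq p <- s | p.1 != a]).
- by move=> p; rewrite mem_filter => /andP[-> /Hs].
- rewrite linearB /= cv scalerBr linear_sum scaler_sumr /=; congr (_ - _).
  rewrite -!(big_filter s); apply: eq_big_seq => p.
  by rewrite mem_filter => /andP[/eqP <- /Hs].
by rewrite big_filter [in LHS]v_sum (bigID (fun p => p.1 == a)) /= addrC addrK.
Qed.

End EigenSum.

(** * Free algebras and their morphisms *)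

Section FreeAlgebraScaling.
Variables (K : comNzRingType) (M : monomType).
Implicit Types x y : {malg K[M]}.

Lemma malg_scalerAr c x y : c *: (x * y) = x * (c *: y).
Proof.
rewrite (malgMEw (fsubset_refl (msupp x)) (msuppZ_le c y)) malgME.
rewrite scaler_sumr; apply: eq_bigr => u _.
rewrite scaler_sumr; apply: eq_bigr => v _.
apply/malgP => w; rewrite mcoeffZ !mcoeffU mcoeffZ -mulrnAr.
by rewrite -!mulrnAr mulrCA.
Qed.

End FreeAlgebraScaling.

Section FreeExt.
Variables (X Y : choiceType) (h : X -> free_alg Y).
Implicit Types x y : free_alg X.

Let prod_h (w : {fmonom X}) : free_alg Y := \prod_(g <- (w : seq X)) h g.

Lemma prod_h_mmorph : mmorphism prod_h.
Proof.
split=> [u v|]; first by rewrite /prod_h fmM big_cat.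
by rewrite /prod_h fm1 big_nil.
Qed.
HB.instance Definition _ :=
  isMultiplicative.Build {fmonom X} (free_alg Y) prod_h prod_h_mmorph.

(** Multiplicativity is inherited from the extension of a monoid morphism to a
    monoid algebra, coefficients being sent to central elements. *)
Lemma free_extE x : free_ext h x = mmap (GRing.in_alg (free_alg Y)) prod_h x.
Proof. by apply: eq_bigr => w _; rewrite mulr_algl. Qed.

Lemma free_extM x y : free_ext h (x * y) = free_ext h x * free_ext h y.
Proof.
rewrite !free_extE; apply: (commr_mmap_is_multiplicative _).1 => g m m'.
rewrite /GRing.comm /= mulr_algl.
by rewrite -[X in _ *: X]mulr1; exact: malg_scalerAr.
Qed.

Lemma free_ext1 : free_ext h 1 = 1.
Proof. by rewrite free_extE mmap1. Qed.

Lemma free_ext_linear c x y :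
  free_ext h (c *: x + y) = c *: free_ext h x + free_ext h y.
Proof. by rewrite !free_extE mmapD mmapZ mulr_algl. Qed.

Lemma free_ext_letter g : free_ext h (letterE g) = h g.
Proof. by rewrite free_extE mmapU /= scale1r mul1r /prod_h fmU big_seq1. Qed.

End FreeExt.

(** * Quantum factorials and the q-binomial theorem *)

Section GaussianCoefficients.
Variable K : fieldType.

(** The coefficient of (-z)^k in (1 - z)(1 - v z)..(1 - v^(n-1) z), that is,
    v^(k(k-1)/2) times the Gaussian binomial coefficient in v.  The recursion
    takes out the factor 1 - z rather than the last one, as qad does below. *)
Fixpoint qcoef (v : K) (n k : nat) : K :=
  match n, k with
  | _, 0 => 1
  | 0, _.+1 => 0
  | n'.+1, k'.+1 => v ^+ k'.+1 * qcoef v n' k'.+1 + v ^+ k' * qcoef v n' k'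
  end.

Lemma qcoef0 v n : qcoef v n 0 = 1. Proof. by case: n. Qed.

Lemma qcoef_gt v n k : (n < k)%N -> qcoef v n k = 0.
Proof.
elim: n k => [|n IHn] [|k] //= lt_nk.
by rewrite !IHn ?mulr0 ?addr0 //; lia.
Qed.

End GaussianCoefficients.

Section QuantumIntegers.
Variables (K : fieldType) (Q : K).
Hypothesis Q_neq0 : Q != 0.
Hypothesis Q_not_root : forall n, (0 < n)%N -> Q ^+ n != 1.

Definition qnum n : K := (Q ^+ n - Q ^- n) / (Q - Q^-1).
Definition qnum_fact n : K := \prod_(1 <= m < n.+1) qnum m.

Lemma qdiff_neq0 n : (0 < n)%N -> Q ^+ n - Q ^- n != 0.
Proof.
move=> n_gt0; rewrite subr_eq0 -(inj_eq (mulfI (expf_neq0 n Q_neq0))).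
by rewrite divff ?expf_neq0 // -exprD Q_not_root // addn_gt0 n_gt0.
Qed.

Lemma qnumD m n : Q ^+ m * qnum (m + n) = Q ^+ (m + n) * qnum m + qnum n.
Proof.
rewrite /qnum !mulrA -mulrDl; congr (_ / _).
rewrite !exprD !invfM; field.
by rewrite !expf_neq0.
Qed.

Lemma qnum_neq0 n : (0 < n)%N -> qnum n != 0.
Proof.
move=> n_gt0; rewrite mulf_neq0 ?qdiff_neq0 // invr_eq0.
exact: (@qdiff_neq0 1).
Qed.

Lemma qnum_fact0 : qnum_fact 0 = 1.
Proof. by rewrite /qnum_fact big_geq. Qed.

Lemma qnum_factS n : qnum_fact n.+1 = qnum_fact n * qnum n.+1.
Proof. by rewrite /qnum_fact big_nat_recr. Qed.

Lemma qnum_fact_neq0 n : qnum_fact n != 0.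
Proof.
elim: n => [|n IHn]; first by rewrite qnum_fact0 oner_eq0.
by rewrite qnum_factS mulf_neq0 ?qnum_neq0.
Qed.

(** Comparison of the Gaussian binomials in v = Q^2 with those symmetric under
    the inversion of Q: they differ by Q^(k(n-k)), which with v^(k(k-1)/2) makes
    Q^(k(n-1)).  Multiplying by Q^k and by the factorials avoids subtraction in
    exponents and division. *)
Lemma qcoefE n k : (k <= n)%N ->
  Q ^+ k * qcoef (Q ^+ 2) n k * (qnum_fact k * qnum_fact (n - k)) =
  Q ^+ (k * n) * qnum_fact n.
Proof.
elim: n k => [|n IHn] [|k] // le_kn.
- by rewrite qcoef0 subnn qnum_fact0 mul0n !expr0 !mulr1.
- by rewrite qcoef0 subn0 qnum_fact0 mul0n !expr0 !mul1r.
rewrite subSS qnum_factS [qcoef _ _ _]/=.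
have IHk := IHn k le_kn.
have [m def_n] : exists m, n = (k + m)%N by exists (n - k)%N; lia.
(* The factor [n - k] lets the case k = n, where both sides vanish, be included:
   the induction hypothesis does not apply to k + 1 there. *)
have IHk1 : Q ^+ k.+1 * qcoef (Q ^+ 2) n k.+1 *
    (qnum_fact k * qnum k.+1 * qnum_fact (n - k)) =
    Q ^+ (k.+1 * n) * qnum_fact n * qnum (n - k).
  have [-> | lt_kn] := eqVneq k n.
    rewrite qcoef_gt // subnn /qnum expr0 invr1 subrr; ring.
  have -> : (n - k)%N = (n - k.+1).+1 by lia.
  rewrite -IHn 1?ltn_neqAle ?lt_kn // !qnum_factS; ring.
have qD := qnumD m k.+1.
rewrite qnum_factS.
have -> : n.+1 = (m + k.+1)%N by lia.
move: IHk IHk1; have -> : (n - k)%N = m by lia.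
set c0 := qcoef _ _ k; set c1 := qcoef _ _ k.+1 => IHk IHk1.
transitivity (Q ^+ k.+1 * c1 * (qnum_fact k * qnum k.+1 * qnum_fact m) *
    Q ^+ 2 ^+ k.+1 + Q ^+ k * c0 * (qnum_fact k * qnum_fact m) * qnum k.+1 *
    Q ^+ 2 ^+ k * Q).
  by rewrite exprSr; ring.
rewrite IHk IHk1 def_n.
transitivity (Q ^+ (k * (k + m)) * qnum_fact (k + m) * Q ^+ (k + k).+1 *
  (Q ^+ (m + k.+1) * qnum m + qnum k.+1)).
  have sqr_exp : Q ^+ 2 ^+ k = Q ^+ k * Q ^+ k by rewrite -exprMn -expr2.
  rewrite [Q ^+ 2 ^+ k.+1]exprS sqr_exp mulSn [Q ^+ (k + k).+1]exprS.
  by rewrite [Q ^+ (m + k.+1)]exprD [Q ^+ k.+1]exprS !exprD; ring.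
have -> : (k.+1 * (m + k.+1))%N = (k * (k + m) + ((k + k).+1 + m))%N by nia.
by rewrite -qD addnC !exprD; ring.
Qed.

End QuantumIntegers.

(** * Iterated q-commutators in a presented algebra *)

Section PresentedAlgebra.
Variables (K : fieldType) (A : lalgType K) (S : A -> Prop).
Hypothesis scalerAr : forall (c : K) (x y : A), c *: (x * y) = x * (c *: y).
Local Notation R := (alg_quot S).
Local Notation cl := (aq_class S).
Implicit Types (u w y : R) (c v : K).

Lemma aq_class_linear : linear cl.
Proof. by move=> c x y; rewrite -aq_addE -aq_scaleE. Qed.
HB.instance Definition _ := GRing.isLinear.Build K A R *:%R cl
  aq_class_linear.

Lemma aq_class_monoid : monoid_morphism cl.
Proof. by split=> [|x y]; [reflexivity | rewrite -aq_mulE]. Qed.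
HB.instance Definition _ := GRing.isMonoidMorphism.Build A R cl
  aq_class_monoid.

Lemma aq_classM (x y : A) : cl (x * y) = cl x * cl y.
Proof. exact: rmorphM. Qed.

Lemma aq_classZ c x : cl (c *: x) = c *: cl x.
Proof. exact: linearZ. Qed.

Lemma aq_class_rel x : S x -> cl x = 0.
Proof. by move=> Sx; apply/aq_classP; rewrite subr0; apply: IdealGen. Qed.

Lemma aq_scalerAl c u w : c *: (u * w) = (c *: u) * w.
Proof.
elim/aq_ind: u => x; elim/aq_ind: w => y.
by rewrite -aq_classM -!aq_classZ -aq_classM scalerAl.
Qed.

Lemma aq_scalerAr c u w : c *: (u * w) = u * (c *: w).
Proof.
elim/aq_ind: u => x; elim/aq_ind: w => y.
by rewrite -aq_classM -!aq_classZ -aq_classM scalerAr.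
Qed.

(** The parameter is multiplied by v at each step because it depends
    multiplicatively on the weight of the element bracketed with y, and the
    bracket adds the weight of y. *)
Fixpoint qad (v : K) (y : R) n (s : K) (w : R) : R :=
  if n is m.+1 then qad v y m (s * v) (y * w - s *: (w * y)) else w.

Lemma qad_linear v y n s : linear (qad v y n s).
Proof.
elim: n s => [|n IHn] s c w w' //=.
have -> : y * (c *: w + w') - s *: ((c *: w + w') * y) =
    c *: (y * w - s *: (w * y)) + (y * w' - s *: (w' * y)).
  rewrite mulrDr mulrDl scalerDr -aq_scalerAr -aq_scalerAl !scalerA mulrC.
  by rewrite scalerBr scalerA opprD addrACA.
exact: IHn.
Qed.
HB.instance Definition _ v y n s :=
  GRing.isLinear.Build K R R *:%R (qad v y n s) (qad_linear v y n s).

Lemma qadD v y n s w w' : qad v y n s (w + w') = qad v y n s w + qad v y n s w'.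
Proof. exact: linearD. Qed.

Lemma qadZ v y n s c w : qad v y n s (c *: w) = c *: qad v y n s w.
Proof. exact: linearZ. Qed.

(** By the q-Leibniz rule, the first q-commutator of w w' is a combination of two
    products, in each of which the order of one factor has dropped by one; so
    orders add up as nilpotency orders do under a derivation. *)
Lemma qad_mul_eq0 v y a b n s s' w w' :
  qad v y a s w = 0 -> qad v y b s' w' = 0 -> (a + b <= n.+1)%N ->
  qad v y n (s * s') (w * w') = 0.
Proof.
elim: n a b s s' w w' => [|n IHn] [|a] [|b] s s' w w' wa wb le_n.
all: try by rewrite [w]wa mul0r linear0.
all: try by rewrite [w']wb mulr0 linear0.
- lia.
have -> : qad v y n.+1 (s * s') (w * w') =
    qad v y n (s * v * s') ((y * w - s *: (w * y)) * w') +
    s *: qad v y n (s * (s' * v)) (w * (y * w' - s' *: (w' * y))).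
  rewrite -qadZ mulrA (mulrAC s v) -qadD; congr (qad v y n _ _).
  rewrite mulrBl mulrBr -aq_scalerAl -aq_scalerAr scalerBr scalerA !mulrA.
  by rewrite subrKA.
rewrite (IHn a b.+1) ?(IHn a.+1 b) ?scaler0 ?addr0 //; lia.
Qed.

Lemma qadE v y n s w :
  qad v y n s w =
  \sum_(k < n.+1) ((- s) ^+ k * qcoef v n k) *: (y ^+ (n - k) * w * y ^+ k).
Proof.
elim: n s w => [|n IHn] s w.
  by rewrite big_ord1 !mul1r mulr1 scale1r.
pose T k := y ^+ (n.+1 - k) * w * y ^+ k.
rewrite [LHS]IHn.
transitivity (\sum_(k < n.+1) ((- s) ^+ k * (v ^+ k * qcoef v n k)) *: T k
   + \sum_(k < n.+1) ((- s) ^+ k.+1 * (v ^+ k * qcoef v n k)) *: T k.+1).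
  rewrite -big_split; apply: eq_bigr => k _.
  have le_kn : (k <= n)%N by rewrite -ltnS.
  rewrite /T subSS (subSn le_kn).
  rewrite mulrBr mulrBl scalerBr -aq_scalerAr -aq_scalerAl scalerA.
  rewrite -scaleNr exprSr exprS !mulrA; congr (_ *: _ + _ *: _).
  - by rewrite -mulNr exprMn.
  - by rewrite -(mulNr s v) exprMn; ring.
  by rewrite -mulrA -exprS.
rewrite [in RHS]big_ord_recl [in LHS]big_ord_recl -addrA; congr (_ + _).
  by rewrite !qcoef0 !mul1r.
rewrite [in RHS](eq_bigr (fun k : 'I_n.+1 =>
   ((- s) ^+ k.+1 * (v ^+ k.+1 * qcoef v n k.+1)) *: T k.+1 +
   ((- s) ^+ k.+1 * (v ^+ k * qcoef v n k)) *: T k.+1)); last first.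
  by move=> k _; rewrite -scalerDl -mulrDr.
rewrite big_split; congr (_ + _).
rewrite [in RHS]big_ord_recr qcoef_gt ?ltnSn // !mulr0 scale0r.
exact/esym/addr0.
Qed.

Section SerreSum.
Variable Q : K.
Hypothesis Q_neq0 : Q != 0.
Hypothesis Q_not_root : forall n, (0 < n)%N -> Q ^+ n != 1.

(** The parameter Q^(-n) is the one for which the power Q^(kn) in the coefficient
    of y^(n+1-k) w y^k cancels. *)
Lemma qad_serreE y n w :
  qad (Q ^+ 2) y n.+1 (Q ^- n) w =
  \sum_(k < n.+2) ((-1) ^+ k *
    (qnum_fact Q n.+1 / (qnum_fact Q k * qnum_fact Q (n.+1 - k)))) *:
    (y ^+ (n.+1 - k) * w * y ^+ k).
Proof.
rewrite qadE; apply: eq_bigr => k _; congr (_ *: _).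
rewrite (exprNn (Q ^- n)) -mulrA; congr (_ * _).
have le_kn : (k <= n.+1)%N by rewrite -ltnS.
have Qk_neq0 : Q ^+ k != 0 by rewrite expf_neq0.
have fact_neq0 : qnum_fact Q k * qnum_fact Q (n.+1 - k) != 0.
  by rewrite mulf_neq0 ?qnum_fact_neq0.
apply: (mulfI Qk_neq0); apply: (mulIf fact_neq0).
rewrite -[RHS]mulrA divfK //.
move: (qcoefE Q_neq0 le_kn) fact_neq0; set c := qcoef _ _ _.
set d := qnum_fact Q k * _ => Ec d_neq0.
transitivity (Q ^- n ^+ k * (Q ^+ k * c * d)); first by ring.
rewrite {}Ec mulnS exprD exprVn -exprM (mulnC k n).
by field; rewrite expf_neq0.
Qed.

Lemma serre_divided_powers y n w :
  \sum_(p < n.+2) (-1) ^+ p *: (((qnum_fact Q p)^-1 *: y ^+ p) * w *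
    ((qnum_fact Q (n.+1 - p))^-1 *: y ^+ (n.+1 - p))) =
  ((-1) ^+ n.+1 / qnum_fact Q n.+1) *: qad (Q ^+ 2) y n.+1 (Q ^- n) w.
Proof.
rewrite qad_serreE scaler_sumr (reindex_inj rev_ord_inj).
apply: eq_bigr => k _; rewrite [nat_of_ord _]/= subSS subKn -1?ltnS //.
rewrite -!aq_scalerAl -aq_scalerAr !scalerA; congr (_ *: _).
rewrite -signr_odd oddB -1?ltnS // signr_addb !signr_odd.
have fact_neq0 m : qnum_fact Q m != 0 by exact: qnum_fact_neq0.
by field; rewrite !fact_neq0.
Qed.

End SerreSum.

(** * Weight components satisfying Serre relations *)

Section Conjugation.
Variables (g g' y : R) (z x v : K) (b : nat).
Hypothesis gK : g * g' = 1.
Hypothesis g'K : g' * g = 1.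

Definition conj w := g * w * g'.

Lemma conj_linear : linear conj.
Proof.
move=> c u w; by rewrite /conj mulrDr mulrDl -aq_scalerAr -aq_scalerAl.
Qed.
HB.instance Definition _ := GRing.isLinear.Build K R R *:%R conj conj_linear.

Lemma conj_eigen_sum (I : eqType) (s : seq I) d (c : I -> K) (w : I -> R) :
  {in s, forall i, conj (w i) = d *: w i} ->
  conj (\sum_(i <- s) c i *: w i) = d *: \sum_(i <- s) c i *: w i.
Proof.
move=> cw; rewrite linear_sum scaler_sumr; apply: eq_big_seq => i /cw cwi.
by rewrite linearZ /= cwi !scalerA mulrC.
Qed.

Lemma conjM u w : conj (u * w) = conj u * conj w.
Proof. by rewrite /conj -!mulrA (mulrA g') g'K mul1r. Qed.

Lemma conj_eigen_prod (I : Type) (s : seq I) (d : I -> K) (w : I -> R) :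
  (forall i, conj (w i) = d i *: w i) ->
  conj (\prod_(i <- s) w i) = (\prod_(i <- s) d i) *: \prod_(i <- s) w i.
Proof.
move=> cw; elim: s => [|i s IHs].
  by rewrite !big_nil /conj mulr1 gK scale1r.
by rewrite !big_cons conjM IHs cw -aq_scalerAl -aq_scalerAr scalerA.
Qed.

(** The degree m is seen on the conjugation eigenvalue z^m, and the order and
    the parameter of the q-commutators vary with m as for words in the f_jk,
    where b stands for - a_ij and x for the inverse of q_i. *)
Definition serre_weight m w : Prop :=
  conj w = z ^+ m *: w /\ qad v y (m * b).+1 (x ^+ (m * b)) w = 0.

Lemma serre_weightM m n u w :
  serre_weight m u -> serre_weight n w -> serre_weight (m + n) (u * w).
Proof.
move=> [cu Su] [cw Sw]; split.
  by rewrite conjM cu cw -aq_scalerAl -aq_scalerAr scalerA exprD.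
by rewrite mulnDl exprD; apply: qad_mul_eq0 Su Sw _; lia.
Qed.

Lemma serre_weightZ m c w : serre_weight m w -> serre_weight m (c *: w).
Proof.
move=> [cw Sw]; split; last by rewrite qadZ Sw scaler0.
by rewrite linearZ /= cw !scalerA mulrC.
Qed.

(** The summands are kept in a list, with possible repetitions of degrees, as
    products and linear combinations of such lists are immediate. *)
Definition serre_span u : Prop :=
  exists s : seq (nat * R),
    {in s, forall p, serre_weight p.1 p.2} /\ u = \sum_(p <- s) p.2.

Lemma serre_span_weight m w : serre_weight m w -> serre_span w.
Proof.
move=> Sw; exists [:: (m, w)]; rewrite big_seq1; split=> // p.
by rewrite inE => /eqP ->.
Qed.

Lemma serre_span1 : serre_span 1.
Proof.
apply: (@serre_span_weight 0); split; rewrite ?mul0n ?expr0.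
  by rewrite /conj mulr1 gK scale1r.
by rewrite /= mulr1 mul1r scale1r subrr.
Qed.

Lemma serre_span_lin c u w :
  serre_span u -> serre_span w -> serre_span (c *: u + w).
Proof.
move=> [s [Ss ->]] [s' [Ss' ->]].
exists ([seq (p.1, c *: p.2) | p <- s] ++ s'); split.
  move=> p; rewrite mem_cat => /orP[/mapP[p' /Ss Sp' ->]|/Ss' //].
  exact: serre_weightZ.
by rewrite big_cat big_map scaler_sumr.
Qed.

Lemma serre_spanM u w : serre_span u -> serre_span w -> serre_span (u * w).
Proof.
move=> [s [Ss ->]] [s' [Ss' ->]].
exists [seq ((p.1 + p'.1)%N, p.2 * p'.2) | p <- s, p' <- s']; split.
  by move=> p /allpairsP[[p1 p2] /= [/Ss Sp1 /Ss' Sp2 ->]]; apply: serre_weightM.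
rewrite big_allpairs_dep; exact: big_distrlr.
Qed.

(** An element of the span that is itself of weight m is the sum of the terms of
    degree m alone, each of which has the required order. *)
Lemma serre_span_homog m u :
  injective (GRing.exp z) -> serre_span u -> conj u = z ^+ m *: u ->
  qad v y (m * b).+1 (x ^+ (m * b)) u = 0.
Proof.
move=> z_inj [s [Ss u_sum]] cu.
rewrite (@eigen_sum_filter _ _ conj (z ^+ m)
  [seq (z ^+ p.1, p.2) | p <- s] u) //.
- rewrite linear_sum big_map big_seq_cond big1 // => p.
  by case/andP=> /Ss[_ Sp] /eqP/z_inj p_m; rewrite -p_m.
- by move=> p /mapP[p' /Ss[cp' _] ->].
by rewrite big_map.
Qed.

End Conjugation.

End PresentedAlgebra.

(** * The quantum Borcherds-Bozec algebra *)

Lemma exprz_oppr_sum (K : fieldType) (z : K) (I : Type) (s : seq I)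
    (e : I -> int) :
  z != 0 -> \prod_(i <- s) z ^ (- e i) = z ^ (- \sum_(i <- s) e i).
Proof.
move=> z_neq0; elim: s => [|i s IHs]; first by rewrite !big_nil oppr0 expr0z.
by rewrite !big_cons IHs opprD expfzDr.
Qed.

Lemma qvar_neq0 : qvar != 0.
Proof. by rewrite tofrac_eq0 polyX_eq0. Qed.

Lemma qvar_expX n : qvar ^+ n = tofrac ('X^n : {poly rat}).
Proof. by rewrite rmorphXn. Qed.

Lemma qvar_exp_inj : injective (GRing.exp qvar).
Proof.
move=> m n; rewrite !qvar_expX => /eqP; rewrite tofrac_eq => /eqP XmXn.
by apply: succn_inj; rewrite -!(size_polyXn rat) XmXn.
Qed.

Lemma Talg_scalerAr (D : cartan_datum) c (x y : Talg D) :
  c *: (x * y) = x * (c *: y).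
Proof. exact: malg_scalerAr. Qed.

Section BorcherdsBozec.
Variables (D : cartan_datum) (Lh : Uhat D -> Uhat D -> Qq).
Local Notation U := (Uq Lh).
Local Notation clU := (aq_class (rel_U Lh)).

Lemma q_i_neq0 (i : idx D) : q_i i != 0.
Proof. by rewrite expf_neq0 // qvar_neq0. Qed.

Lemma q_i_not_root (i : idx D) n : (0 < n)%N -> q_i i ^+ n != 1.
Proof.
move=> n_gt0; rewrite -exprM -(expr0 qvar) (inj_eq qvar_exp_inj).
by rewrite -lt0n muln_gt0 symz_gt0.
Qed.

Lemma F_to_U_lin c x y :
  F_to_U Lh (c *: x + y) = c *: F_to_U Lh x + F_to_U Lh y.
Proof. by rewrite /F_to_U /F_to_T free_ext_linear linearP. Qed.

Lemma F_to_UM x y : F_to_U Lh (x * y) = F_to_U Lh x * F_to_U Lh y.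
Proof. by rewrite /F_to_U /F_to_T free_extM aq_classM. Qed.

Lemma F_to_U1 : F_to_U Lh 1 = 1.
Proof. by rewrite /F_to_U /F_to_T free_ext1. Qed.

Lemma fUE x : fU Lh x = clU (fTg x).
Proof. by rewrite /fU /F_to_U /F_to_T free_ext_letter. Qed.

Definition qU h : U := clU (qT h).

Lemma rel_hat0 x : rel_hat x -> clU x = 0.
Proof. by move=> rx; apply/aq_class_rel/RelTilde/RelHat. Qed.

Lemma rel_hat_eq x y : rel_hat (x - y) -> clU x = clU y.
Proof. by move=> rxy; apply/aq_classP/IdealGen/RelTilde/RelHat. Qed.

Lemma qUK h : qU h * qU (- h) = 1.
Proof.
rewrite /qU -aq_classM (rel_hat_eq (RelQD h (- h))) subrr.
by rewrite (rel_hat_eq (RelQ0 D)).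
Qed.

Lemma qUKV h : qU (- h) * qU h = 1.
Proof. by have := qUK (- h); rewrite opprK. Qed.

Lemma conj_fU h x : conj (qU h) (qU (- h)) (fU Lh x) =
  qvar ^ (- ((val x).2%:Z * alpha (val x).1 h)) *: fU Lh x.
Proof.
rewrite fUE; have := rel_hat_eq (RelQF h x).
rewrite aq_classZ aq_classM aq_classM => <-; reflexivity.
Qed.

Lemma conj_word h (w : seq (Iinf D)) :
  conj (qU h) (qU (- h)) (\prod_(g <- w) fU Lh g) =
  qvar ^ (- \sum_(x <- w) (val x).2%:Z * alpha (val x).1 h) *:
    \prod_(g <- w) fU Lh g.
Proof.
rewrite (conj_eigen_prod (@Talg_scalerAr D) (qUK h) (qUKV h) _ (conj_fU h)).
by rewrite exprz_oppr_sum ?qvar_neq0.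
Qed.

Lemma conj_homog mu h x : homog mu x ->
  conj (qU h) (qU (- h)) (F_to_U Lh x) = qvar ^ mu h *: F_to_U Lh x.
Proof.
move=> mu_x.
have -> : F_to_U Lh x =
    \sum_(w <- msupp x) x@_w *: \prod_(g <- (w : seq _)) fU Lh g.
  rewrite /F_to_U /F_to_T /free_ext linear_sum; apply: eq_bigr => w _.
  rewrite linearZ rmorph_prod; congr (_ *: _).
  by apply: eq_bigr => g _; rewrite fUE.
apply: (conj_eigen_sum (@Talg_scalerAr D)) => w xw.
by rewrite conj_word -(mu_x w xw h).
Qed.

Section SerreRelations.
Variables (i : idx D) (hi : is_re i).
Let fi : U := fU Lh (Iinf_re hi).

Lemma neq_re_idx (x : Iinf D) : val x != (i, 1%N) -> i != (val x).1.
Proof.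
case: x => [[j l] jl] /=; apply: contra => /eqP ij.
by move: jl; rewrite -ij /Iinf_pred /= hi => /eqP ->.
Qed.

Lemma serre_lenE (x : Iinf D) : val x != (i, 1%N) ->
  serre_len i x = ((val x).2 * absz (cart i (val x).1)).+1.
Proof.
move=> /neq_re_idx /cart_offdiag; rewrite /serre_len.
by move: (cart _ _) (val x).2 => a l; nia.
Qed.

Lemma serre_fU (x : Iinf D) : val x != (i, 1%N) ->
  let N := serre_len i x in
  \sum_(k < N.+1) ((-1) ^+ k * qbinom i N k) *:
    (fi ^+ (N - k) * fU Lh x * fi ^+ k) = 0.
Proof.
move=> hx N; rewrite -[RHS](rel_hat0 (RelSerreF hi hx)) /serre linear_sum.
apply: eq_bigr => k _; by rewrite linearZ !rmorphM !rmorphXn /fi !fUE.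
Qed.

Lemma qad_fU (x : Iinf D) : val x != (i, 1%N) ->
  let b := absz (cart i (val x).1) in
  qad (q_i i ^+ 2) fi ((val x).2 * b).+1 ((q_i i)^-1 ^+ ((val x).2 * b))
    (fU Lh x) = 0.
Proof.
move=> hx b; rewrite exprVn (qad_serreE (@Talg_scalerAr D)) ?q_i_neq0 //.
  by rewrite -[RHS](serre_fU hx) (serre_lenE hx).
exact: q_i_not_root.
Qed.

End SerreRelations.

Lemma alpha_dvee (j : idx D) : alpha j (dvee j) = 1.
Proof.
by rewrite /alpha /dvee msuppU oner_eq0 big_seq_fset1 mcoeffUU mul1r eqxx.
Qed.

(** Conjugation by q^(d_j) reads off the degree in the f_jk because
    alpha_j(d_j) = 1; the element h_j would not do, as a_jj may vanish. *)
Lemma qvar_exp_dvee (j : idx D) (l : nat) :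
  qvar ^ (- (l%:Z * alpha j (dvee j))) = qvar^-1 ^+ l.
Proof. by rewrite alpha_dvee mulr1 -exprnN exprVn. Qed.

Section ImaginaryGenerators.
Variables (i : idx D) (hi : is_re i) (j : idx D) (hj : ~~ is_re j).
Let b := absz (cart i j).
Let span : U -> Prop :=
  serre_span (qU (dvee j)) (qU (- dvee j)) (fU Lh (Iinf_re hi)) qvar^-1
    (q_i i)^-1 (q_i i ^+ 2) b.

Lemma serre_span_fU (x : Iinf D) : (val x).1 = j -> span (fU Lh x).
Proof.
move=> xj; apply: (@serre_span_weight _ _ _ _ _ _ _ _ _ _ (val x).2); split.
  by rewrite conj_fU xj qvar_exp_dvee.
rewrite /b -xj; apply: qad_fU; apply: contraNneq hj => x_i1.
by rewrite -xj x_i1.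
Qed.

(** An imaginary j differs from the real i, so all the f_jk satisfy Serre
    relations with f_i. *)
Lemma serre_span_subalg l x :
  subalg (fun y => exists2 k, (0 < k < l)%N & y = fF j k) x ->
  span (F_to_U Lh x).
Proof.
elim=> {x} [_ [k /andP[k_gt0 _] ->]||c x y _ Sx _ Sy|x y _ Sx _ Sy].
- have jk : Iinf_pred (j, k) by rewrite /Iinf_pred /= (negPf hj).
  rewrite /fF gtn_eqF // insubT.
  exact: (@serre_span_fU (Sub (j, k) jk)).
- by rewrite F_to_U1; apply: (serre_span1 _ _ _ _ _ (qUK _)).
- rewrite F_to_U_lin.
  exact: (serre_span_lin (@Talg_scalerAr D) _ Sx Sy).
rewrite F_to_UM.
exact: (serre_spanM (@Talg_scalerAr D) (qUKV _) Sx Sy).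
Qed.

(** Membership in the span comes from the expression of u through the f_jk; the
    homogeneous lift of u serves to compute its conjugation eigenvalue. *)
Lemma qad_primitive_gen (L : Falg D -> Falg D -> Qq) (x : Iinf D) (u : U) :
  (val x).1 = j -> is_primitive_gen L x u ->
  qad (q_i i ^+ 2) (fU Lh (Iinf_re hi)) ((val x).2 * b).+1
    ((q_i i)^-1 ^+ ((val x).2 * b)) u = 0.
Proof.
move=> xj [[x0 mu_x0 <-] [y Sy y_u] _].
have z_inj : injective (GRing.exp qvar^-1).
  by move=> m n; rewrite !exprVn => /invr_inj/qvar_exp_inj.
apply: (serre_span_homog (@Talg_scalerAr D) z_inj).
  rewrite -[F_to_U _ _](subrK (fU Lh x)) -y_u -[F_to_U _ _]scale1r.
  apply: (serre_span_lin (@Talg_scalerAr D)); last exact: serre_span_fU.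
  by move: Sy; rewrite xj => /serre_span_subalg.
by rewrite (conj_homog _ mu_x0) xj qvar_exp_dvee.
Qed.

End ImaginaryGenerators.

End BorcherdsBozec.

Theorem proposition2p8 (D : cartan_datum) (nu : Iinf D -> Qq)
  (hnu : forall x, nu_admissible (nu x))
  (L : {bilinear (Falg D) -> (Falg D) -> Qq^o})
  (hL : is_formL nu L)
  (Lh : {bilinear (Uhat D) -> (Uhat D) -> Qq^o})
  (hLh : is_formhat L Lh)
  (t : Iinf D -> Uq Lh)
  (ht : primitive_family L t)
  (i : idx D) (hi : is_re i) (x : Iinf D) (hx : val x != (i, 1%N)) :
  let N := serre_len i x in
  let ti := t (Iinf_re hi) in
  \sum_(p < N.+1) (-1) ^+ p *: (divpow i ti p * t x * divpow i ti (N - p)) = 0.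
Proof.
move=> N ti.
have {ti} -> : ti = fU Lh (Iinf_re hi) by have := ht (Iinf_re hi); rewrite /= hi.
have tx0 : qad (q_i i ^+ 2) (fU Lh (Iinf_re hi))
    ((val x).2 * absz (cart i (val x).1)).+1
    ((q_i i)^-1 ^+ ((val x).2 * absz (cart i (val x).1))) (t x) = 0.
  have := ht x; case: ifPn => [_ -> | x_im]; first exact: qad_fU.
  exact: qad_primitive_gen.
rewrite /N (serre_lenE hi hx).
have := serre_divided_powers (@Talg_scalerAr D) (q_i_neq0 i)
  (@q_i_not_root D i) (fU Lh (Iinf_re hi)) ((val x).2 * absz (cart i (val x).1))
  (t x).
by rewrite -exprVn tx0 scaler0.
Qed.
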